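(* Let $(t_n)_{n\ge0}$ be defined by $t_0=t_1=0$, $t_2=1$ and $t_n=t_{n-1}+t_{n-2}+t_{n-3}$ for $n\ge3$, and let $(r_n)_{n\ge0}$ be defined by $r_0=r_1=0$, $r_2=1$ and $r_n=r_{n-1}+r_{n-3}$ for $n\ge 3$. Then the ratio $\frac{\sqrt[n]{a_n}}{\sqrt[n-1]{a_{n-1}}}$ is strictly decreasing for all $n\ge4$ when $a_n=t_n$ and for all $n\ge 8$ when $a_n=r_n$; that is, $$\frac{\sqrt[n]{a_n}}{\sqrt[n-1]{a_{n-1}}}>\frac{\sqrt[n+1]{a_{n+1}}}{\sqrt[n]{a_n}}$$ holds for all $n\ge 4$ when $a_n=t_n$, and for all $n\ge 8$ when $a_n=r_n$.
   Context: For $y\ge 0$ and an integer $n\ge1$, $\sqrt[n]{y}$ denotes the non-negative real $n$-th root. *)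

(* Defs.v *)
From mathcomp Require Import all_boot all_order all_algebra.
From mathcomp Require Import all_classical all_reals all_analysis.

Set Implicit Arguments.
Unset Strict Implicit.
Unset Printing Implicit Defensive.

Import Order.TTheory GRing.Theory Num.Theory.

Local Open Scope ring_scope.

Fixpoint tribonacci (n : nat) : nat :=
  match n with
  | 0 | 1 => 0
  | 2 => 1
  | ((m.+1 as n2).+1 as n1).+1 => tribonacci n1 + tribonacci n2 + tribonacci m
  end%N.

Fixpoint narayana (n : nat) : nat :=
  match n with
  | 0 | 1 => 0
  | 2 => 1
  | ((m.+1 as n2).+1 as n1).+1 => narayana n1 + narayana m
  end%N.

Lemma tribonacciE (n : nat) : (3 <= n)%N ->
  tribonacci n =
  (tribonacci (n - 1) + tribonacci (n - 2) + tribonacci (n - 3))%N.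
Proof. by case: n => [|[|[|n]]] // _; rewrite !subSS !subn0. Qed.

Lemma narayanaE (n : nat) : (3 <= n)%N ->
  narayana n = (narayana (n - 1) + narayana (n - 3))%N.
Proof. by case: n => [|[|[|n]]] // _; rewrite !subSS !subn0. Qed.

(* Only meaningful for n >= 1 and y >= 0; see nthroot_unique. *)
Definition nthroot {R : realType} (n : nat) (y : R) : R := y `^ (n%:R^-1).

Lemma nthroot_ge0 (R : realType) (n : nat) (y : R) : 0 <= nthroot n y.
Proof. exact: powR_ge0. Qed.

Lemma nthrootK (R : realType) (n : nat) (y : R) :
  (0 < n)%N -> 0 <= y -> nthroot n y ^+ n = y.
Proof.
move=> n0 y0; rewrite -powR_mulrn ?nthroot_ge0// -powRrM.
by rewrite mulVf ?powRr1// pnatr_eq0 -lt0n.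
Qed.

Lemma nthroot_unique (R : realType) (n : nat) (x y : R) :
  (0 < n)%N -> 0 <= x -> x ^+ n = y -> x = nthroot n y.
Proof.
move=> n0 x0 <-; rewrite /nthroot -powR_mulrn// -powRrM.
by rewrite divff ?powRr1// pnatr_eq0 -lt0n.
Qed.

(* Main.v *)
From Stdlib Require Import NArith.
From Pilot Require Import Defs.
From mathcomp Require Import all_boot all_order all_algebra.
From mathcomp Require Import all_classical all_reals all_analysis.
From mathcomp Require Import zify ring lra.

Set Implicit Arguments.
Unset Strict Implicit.
Unset Printing Implicit Defensive.

Import Order.TTheory GRing.Theory Num.Theory Pilot.Defs.

Local Open Scope ring_scope.

(** Write L_n = ln a_n. Multiplying the logarithm of the inequality by
    n(n+1)(n-1) turns it into

      n^2 (L_{n+1} + L_{n-1} - 2 L_n) < n (L_{n+1} - L_{n-1}) - 2 L_n,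

    that is, n^2 d_n < E_n, with d_n the [log_curvature] and E_n the [log_drift]
    ([nthroot_ratio_ltP]). Both sequences behave like C alpha^n with C < 1, so
    that E_n tends to -2 ln C > 0, while d_n decays exponentially. The proof
    makes this effective without using alpha or C.

    - The integer T = a_{n+1} a_{n-1} - a_n^2 satisfies a linear recurrence whose
      characteristic roots are the products of two distinct roots of the original
      one. Taking absolute values in it already gives 2 |T| <= a_n
      ([turan_tribonacci_bound], [turan_narayana_bound]). As
      d_n = ln (1 + T / a_n^2), it follows that |d_n| <= 1 / a_n
      ([log_curvature_bound]).
    - The drift decreases slowly: E_n - E_{n+1} = - n (d_{n+1} + d_n) - d_{n+1}
      is at most (2 n + 1) / a_n, whereas n^2 / a_n itself drops by more than
      that at each step from n = 15 on, because a_{n+1} >= 4/3 a_n. Hence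
      n^2 / a_n < E_n propagates from one index to all later ones
      ([log_drift_gt]), and it dominates n^2 d_n.

    The induction starts at n = 20, where n^2 / a_n < 3/4 <= E_n follows from
    inequalities between natural numbers. Exponentiating n^2 d_n < E_n gives
    another one, whose evaluation settles each smaller n
    ([nthroot_ratio_lt_of_power_test]). *)

(** * Logarithmic form of the inequality *)

Section Logarithms.
Variable R : realType.
Implicit Types (a : nat -> nat) (n m : nat).

Lemma nthroot_expR n (y : R) : 0 < y -> nthroot n y = expR (n%:R^-1 * ln y).
Proof. by move=> y0; rewrite /nthroot /powR gt_eqF. Qed.

Lemma ln_ge_1subV (x : R) : 0 < x -> 1 - x^-1 <= ln x.
Proof.
move=> x0; have := @expR_ge1Dx R (- ln x).
by rewrite expRN lnK ?posrE//; lra.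
Qed.

Lemma ln_le_sub1 (x : R) : 0 < x -> ln x <= x - 1.
Proof.
move=> x0; have := @expR_ge1Dx R (ln x).
by rewrite lnK ?posrE//; lra.
Qed.

Lemma ln_powers n (x y z : R) : 0 < x -> 0 < y -> 0 < z ->
  ln (z ^+ n / (x ^+ n * y ^+ 2)) = n%:R * (ln z - ln x) - 2 * ln y.
Proof.
move=> x0 y0 z0.
have [xn0 yn0 zn0] : [/\ 0 < x ^+ n, 0 < y ^+ 2 & 0 < z ^+ n].
  by rewrite !exprn_gt0.
rewrite ln_div ?posrE ?mulr_gt0// lnM ?posrE// !lnXn//.
by rewrite mulrBr !mulr_natl opprD addrA.
Qed.

Lemma ltr_ln_powers p q r (x y z : R) : 0 < x -> 0 < y -> 0 < z ->
  (z ^+ p * x ^+ q < y ^+ r)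
  = (p%:R * ln z + q%:R * ln x < r%:R * ln y).
Proof.
move=> x0 y0 z0.
have [xn0 yn0 zn0] : [/\ 0 < x ^+ q, 0 < y ^+ r & 0 < z ^+ p].
  by rewrite !exprn_gt0.
rewrite -ltr_ln ?posrE ?mulr_gt0// lnM ?posrE// !lnXn//.
by rewrite !mulr_natl.
Qed.

Definition lnseq a n : R := ln (a n)%:R.

(** Second difference of ln a at n; n.-1 is only meant for 0 < n. *)
Definition log_curvature a n : R := lnseq a n.+1 + lnseq a n.-1 - 2 * lnseq a n.

(** If ln (a n) = n l + k exactly, this is the constant - 2 k; it plays the role
    of the limit -2 ln C of an asymptotically geometric sequence C alpha^n. *)
Definition log_drift a n : R :=
  n%:R * (lnseq a n.+1 - lnseq a n.-1) - 2 * lnseq a n.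

(** The drift changes only through curvatures, because it is constant on
    geometric sequences. *)
Lemma log_driftS a m : log_drift a m.+2 = log_drift a m.+1
  + m.+1%:R * (log_curvature a m.+2 + log_curvature a m.+1)
  + log_curvature a m.+2.
Proof. rewrite /log_drift /log_curvature /= -(natr1 m.+1); ring. Qed.

(** With t = m, the difference of the two sides of the drift inequality is
    t (t + 1) (t + 2) times the difference of the logarithms of the ratios. *)
Lemma nthroot_ratio_ltP a m : (0 < m)%N ->
  (0 < a m)%N -> (0 < a m.+1)%N -> (0 < a m.+2)%N ->
  (nthroot m.+2 ((a m.+2)%:R : R) / nthroot m.+1 ((a m.+1)%:R : R)
     < nthroot m.+1 ((a m.+1)%:R : R) / nthroot m ((a m)%:R : R))
  = (m.+1%:R ^+ 2 * log_curvature a m.+1 < log_drift a m.+1).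
Proof.
move=> m0 a0 a1 a2; rewrite !nthroot_expR ?ltr0n// -!expRN -!expRD ltr_expR.
rewrite /log_drift /log_curvature /lnseq /=.
set x := ln _; set y := ln (a m.+1)%:R; set z := ln (a m)%:R.
have mp : 0 < m%:R :> R by rewrite ltr0n.
rewrite -(natr1 m.+1) -(natr1 m); move: (m%:R : R) mp => t t0.
rewrite -subr_gt0 -[in RHS]subr_gt0.
have -> : (t + 1) * (x - z) - 2 * y - (t + 1) ^+ 2 * (x + z - 2 * y)
  = t * (t + 1) * (t + 1 + 1) * ((t + 1)^-1 * y - t^-1 * z
      - ((t + 1 + 1)^-1 * x - (t + 1)^-1 * y)).
  by field; rewrite !gt_eqF//; lra.
by rewrite pmulr_rgt0// !mulr_gt0//; lra.
Qed.

End Logarithms.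

(** * Propagation of the inequality *)

Section Tail.
Variables (R : realType) (a : nat -> nat).

(** The negative of the Turan (log-concavity) expression at m.+1. *)
Definition turan (a : nat -> nat) m : int :=
  (a m.+2)%:Z * (a m)%:Z - (a m.+1)%:Z ^+ 2.

(** The curvature is ln w with w = a_{m+2} a_m / a_{m+1}^2, which is enclosed
    between 1 - 1 / w and w - 1; in both bounds the numerator is [turan a m].
    The hypothesis a_{m+1} <= 2 a_m keeps the denominator of 1 - 1 / w under
    control. *)
Lemma log_curvature_bound m :
    (0 < a m)%N -> (a m.+1 <= 2 * a m)%N -> (0 < a m.+1 <= a m.+2)%N ->
    2 * `|turan a m| <= (a m.+1)%:Z ->
  `|log_curvature R a m.+1| <= (a m.+1)%:R^-1.
Proof.
rewrite /turan /log_curvature /lnseq /=.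
move: (a m) (a m.+1) (a m.+2) => x y z x0 yx /andP[y0 yz] D.
have xp : 0 < x%:R :> R by rewrite ltr0n.
have yp : 0 < y%:R :> R by rewrite ltr0n.
have zp : 0 < z%:R :> R by rewrite ltr0n (leq_trans y0).
have yx' : y%:R <= 2 * x%:R :> R by rewrite -natrM ler_nat.
have yz' : y%:R <= z%:R :> R by rewrite ler_nat.
have {D} : `|z%:R * x%:R - y%:R ^+ 2 : R| <= y%:R / 2.
  move: D; rewrite -(ler_int R) rmorphM/= intr_norm rmorphB/= rmorphXn rmorphM/=.
  by rewrite -!pmulrn; lra.
rewrite ler_norml => /andP[D1 D2].
have -> : ln z%:R + ln x%:R - 2 * ln y%:R = ln (z%:R * x%:R / y%:R ^+ 2) :> R.
  by rewrite ln_div ?posrE ?mulr_gt0 ?exprn_gt0// lnM ?posrE// lnXn// mulr_natl.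
have wp : 0 < z%:R * x%:R / y%:R ^+ 2 :> R.
  by rewrite !mulr_gt0 ?invr_gt0 ?exprn_gt0.
have := ln_ge_1subV wp; have := ln_le_sub1 wp.
rewrite ler_norml => h1 h2; apply/andP; split.
  apply: le_trans h2; rewrite invf_div -subr_ge0.
  have -> : 1 - y%:R ^+ 2 / (z%:R * x%:R) - - y%:R^-1
    = ((z%:R * x%:R - y%:R ^+ 2) * y%:R + z%:R * x%:R) / (z%:R * x%:R * y%:R) :> R.
    by field; rewrite !gt_eqF.
  apply: divr_ge0; last by apply: ltW; rewrite !mulr_gt0.
  nra.
apply: le_trans h1 _; rewrite -subr_ge0.
have -> : y%:R^-1 - (z%:R * x%:R / y%:R ^+ 2 - 1)
    = (y%:R - (z%:R * x%:R - y%:R ^+ 2)) / y%:R ^+ 2 :> R.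
  by field; rewrite gt_eqF.
by rewrite divr_ge0// ?exprn_ge0//; lra.
Qed.

Variable N : nat.
Hypothesis N14 : (14 <= N)%N.
Hypothesis a_gt0 : forall m, (N <= m)%N -> (0 < a m)%N.
Hypothesis a_le2 : forall m, (N <= m)%N -> (a m.+1 <= 2 * a m)%N.
Hypothesis a_ge43 : forall m, (N <= m)%N -> (4 * a m <= 3 * a m.+1)%N.
Hypothesis a_turan : forall m, (N <= m)%N -> 2 * `|turan a m| <= (a m.+1)%:Z.
(* Together, the next two hypotheses give the inequality at N.+1, with 3/4
   separating its two sides. *)
Hypothesis a_large : (4 * N.+1 ^ 2 < 3 * a N.+1)%N.
Hypothesis a_drift : (4 * (a N ^ N.+1 * a N.+1 ^ 2) <= a N.+2 ^ N.+1)%N.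

Lemma log_curvature_small m : (N <= m)%N -> `|log_curvature R a m.+1| <= (a m.+1)%:R^-1.
Proof.
move=> Nm; apply: log_curvature_bound; rewrite ?a_gt0 ?a_le2 ?a_turan//.
  by have := @a_ge43 m.+1 (leqW Nm); lia.
exact: leqW.
Qed.

(** One step loses at most (2 t + 1) / a_t of drift, with t = m.+1, while the
    left-hand side decreases by at least (t^2 - 3/4 (t + 1)^2) / a_t. The latter
    is the larger one as soon as t^2 - 14 t - 7 >= 0, that is, t >= 15. *)
Lemma log_drift_gt m : (N <= m)%N ->
  m.+1%:R ^+ 2 / (a m.+1)%:R < log_drift R a m.+1.
Proof.
elim: m => [|m IH]; first by case: N N14.
rewrite leq_eqVlt => /predU1P[<-|]; last rewrite ltnS => Nm.
  have [x0 y0 z0] : [/\ (0 < a N)%N, (0 < a N.+1)%N & (0 < a N.+2)%N].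
    by rewrite !a_gt0// ltnW// ltnS.
  have xp : 0 < (a N)%:R :> R by rewrite ltr0n.
  have yp : 0 < (a N.+1)%:R :> R by rewrite ltr0n.
  have zp : 0 < (a N.+2)%:R :> R by rewrite ltr0n.
  apply: (@lt_le_trans _ _ (1 - 4^-1)).
    rewrite ltr_pdivrMr//; move: a_large.
    rewrite -(ltr_nat R) natrM [in X in _ < X]natrM natrX; lra.
  (* The drift is ln K and K >= 4, so it is at least 1 - 1 / 4. *)
  set K : R := (a N.+2)%:R ^+ N.+1 / ((a N)%:R ^+ N.+1 * (a N.+1)%:R ^+ 2).
  have dp : 0 < (a N)%:R ^+ N.+1 * (a N.+1)%:R ^+ 2 :> R.
    by rewrite mulr_gt0 ?exprn_gt0.
  have Kp : 0 < K by rewrite divr_gt0 ?exprn_gt0.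
  have K4 : 4 <= K.
    by rewrite /K ler_pdivlMr// -!natrX -!natrM ler_nat.
  have -> : log_drift R a N.+1 = ln K.
    by rewrite /log_drift /lnseq /= /K ln_powers.
  apply: le_trans (ln_ge_1subV Kp); rewrite lerD2l lerN2.
  by rewrite lef_pV2// posrE.
have {IH} := IH Nm; rewrite log_driftS.
have := log_curvature_small Nm; have := log_curvature_small (leqW Nm); rewrite !ler_norml.
have := a_ge43 (leqW Nm).
have xp : 0 < (a m.+1)%:R :> R by rewrite ltr0n a_gt0// leqW.
have yp : 0 < (a m.+2)%:R :> R by rewrite ltr0n a_gt0// !leqW.
rewrite -(ler_nat R) !natrM => h43.
have {h43} : 4 * (a m.+2)%:R^-1 <= 3 * (a m.+1)%:R^-1 :> R.
  have -> : 4 * (a m.+2)%:R^-1 = 4 * (a m.+1)%:R / ((a m.+1)%:R * (a m.+2)%:R) :> R.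
    by field; rewrite !gt_eqF.
  by rewrite ler_pdivrMr ?mulr_gt0//; move: h43; rewrite mulrA divfK ?gt_eqF.
have : 0 < (a m.+1)%:R^-1 :> R by rewrite invr_gt0.
have : 15 <= m.+1%:R :> R by rewrite ler_nat ltnS (leq_trans N14).
rewrite -(natr1 m.+1).
move: (m.+1%:R : R) (a m.+1)%:R^-1 (a m.+2)%:R^-1 => t u v.
move: (log_curvature R a m.+2) (log_curvature R a m.+1) (log_drift R a m.+1).
move=> d' d E t15 u0 vu /andP[d'1 d'2] /andP[d1 d2] hE.
have h1 : t * (d' + d) >= - t * (u + v) by nra.
have h2 : (t + 1) ^+ 2 * v <= (t + 1) ^+ 2 * (3 / 4 * u).
  by apply: ler_wpM2l; [exact: sqr_ge0|lra].
have h3 : t * (u + v) <= t * (2 * u) by apply: ler_wpM2l; lra.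
have h4 : 0 <= (t ^+ 2 - 14 * t - 7) * u by apply: mulr_ge0; [nra|lra].
lra.
Qed.

Lemma nthroot_ratio_decr_tail m : (N <= m)%N ->
  nthroot m.+2 ((a m.+2)%:R : R) / nthroot m.+1 ((a m.+1)%:R : R)
     < nthroot m.+1 ((a m.+1)%:R : R) / nthroot m ((a m)%:R : R).
Proof.
move=> Nm; rewrite nthroot_ratio_ltP ?a_gt0 ?leqW//.
  apply: le_lt_trans (log_drift_gt Nm).
  apply: ler_wpM2l; first exact: sqr_ge0.
  by apply: le_trans (log_curvature_small Nm); exact: ler_norm.
by apply: leq_trans Nm; exact: leq_trans N14.
Qed.

End Tail.

(** * Numerical verification *)

Section SmallCases.

(** Raising to the power m (m + 1) (m + 2) clears the roots. The numbers reach
    thousands of bits, so they are compared in binary. *)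
Definition power_test (a : nat -> nat) (m : nat) : bool :=
  let x := N.of_nat (a m) in
  let y := N.of_nat (a m.+1) in
  let z := N.of_nat (a m.+2) in
  N.ltb (z ^ N.of_nat (m.+1 * m) * x ^ N.of_nat (m.+1 * m.+2))
        (y ^ N.of_nat (2 * (m * m.+2))).

Lemma N_of_nat_expn x n : N.of_nat (x ^ n) = N.pow (N.of_nat x) (N.of_nat n).
Proof.
elim: n => [|n IHn]; first by rewrite expn0.
by rewrite expnS Nat2N.inj_mul IHn Nat2N.inj_succ N.pow_succ_r'.
Qed.

Lemma power_testP (a : nat -> nat) m :
  power_test a m =
  (a m.+2 ^ (m.+1 * m) * a m ^ (m.+1 * m.+2) < a m.+1 ^ (2 * (m * m.+2)))%N.
Proof.
rewrite /power_test -!N_of_nat_expn -Nat2N.inj_mul.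
apply/idP/idP; lia.
Qed.

Lemma nthroot_ratio_lt_of_power_test (R : realType) (a : nat -> nat) m :
  (0 < m)%N -> [&& 0 < a m, 0 < a m.+1 & 0 < a m.+2]%N -> power_test a m ->
  nthroot m.+2 ((a m.+2)%:R : R) / nthroot m.+1 ((a m.+1)%:R : R)
     < nthroot m.+1 ((a m.+1)%:R : R) / nthroot m ((a m)%:R : R).
Proof.
move=> m0 /and3P[a0 a1 a2]; rewrite nthroot_ratio_ltP//.
rewrite power_testP -(ltr_nat R) natrM !natrX.
rewrite /log_drift /log_curvature /lnseq /=.
have xp : 0 < (a m)%:R :> R by rewrite ltr0n.
have yp : 0 < (a m.+1)%:R :> R by rewrite ltr0n.
have zp : 0 < (a m.+2)%:R :> R by rewrite ltr0n.
rewrite ltr_ln_powers// !natrM -(natr1 m.+1) -(natr1 m).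
lra.
Qed.

Lemma leq_of_N x y : N.leb (N.of_nat x) (N.of_nat y) -> (x <= y)%N.
Proof. lia. Qed.

Lemma leq_powers_of_N c p q x y z :
  N.leb (N.of_nat c * (N.of_nat x ^ N.of_nat p * N.of_nat y ^ N.of_nat q))
        (N.of_nat z ^ N.of_nat p) ->
  (c * (x ^ p * y ^ q) <= z ^ p)%N.
Proof. by rewrite -!N_of_nat_expn -!Nat2N.inj_mul => /leq_of_N. Qed.

End SmallCases.

(** * Reduction to a tail and finitely many cases *)

Lemma nthroot_ratio_decr (R : realType) (a : nat -> nat) M N :
  (0 < M)%N -> (14 <= N)%N ->
  (forall m, (M <= m)%N -> (0 < a m)%N) ->
  (forall m, (N <= m)%N -> (a m.+1 <= 2 * a m)%N) ->
  (forall m, (N <= m)%N -> (4 * a m <= 3 * a m.+1)%N) ->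
  (forall m, (N <= m)%N -> 2 * `|turan a m| <= (a m.+1)%:Z) ->
  (M <= N)%N ->
  (4 * N.+1 ^ 2 < 3 * a N.+1)%N ->
  (4 * (a N ^ N.+1 * a N.+1 ^ 2) <= a N.+2 ^ N.+1)%N ->
  all (power_test a) (iota M (N - M)) ->
  forall n, (M < n)%N ->
     nthroot n ((a n)%:R : R)
       / nthroot (n - 1) ((a (n - 1)%N)%:R : R)
     > nthroot (n + 1) ((a (n + 1)%N)%:R : R)
         / nthroot n ((a n)%:R : R).
Proof.
move=> M0 N14 agt0 ale2 age43 aT MN alarge adrift /allP small [//|m].
rewrite ltnS => Mm.
rewrite addn1 subn1 /=; have [Nm|mN] := leqP N m.
  apply: (nthroot_ratio_decr_tail R N14) => // k Nk; apply: agt0.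
  exact: leq_trans Nk.
apply: nthroot_ratio_lt_of_power_test; first exact: leq_trans Mm.
  by rewrite !agt0// !leqW.
by apply: small; rewrite mem_iota Mm subnKC.
Qed.

(** * The two sequences *)

Lemma tribonacciS n :
  tribonacci n.+3 = (tribonacci n.+2 + tribonacci n.+1 + tribonacci n)%N.
Proof. by []. Qed.

Lemma narayanaS n : narayana n.+3 = (narayana n.+2 + narayana n)%N.
Proof. by []. Qed.

Lemma three_step_induction (P : nat -> Prop) N : P N -> P N.+1 -> P N.+2 ->
  (forall n, (N <= n)%N -> P n -> P n.+1 -> P n.+2 -> P n.+3) ->
  forall n, (N <= n)%N -> P n.
Proof.
move=> P0 P1 P2 PS n Nn.
suff [] : [/\ P n, P n.+1 & P n.+2] by [].
elim: n Nn => [|n IH]; first by rewrite leqn0 => /eqP NE; rewrite NE in P0 P1 P2 *.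
rewrite leq_eqVlt => /predU1P[<-//|]; rewrite ltnS => Nn.
have [? ? ?] := IH Nn; split=> //; exact: PS.
Qed.

(** With roots r, s, t of x^3 = x^2 + x + 1 and r s t = 1, the products of two
    roots are the inverses of the roots, hence the reversed recurrence. *)
Lemma turan_tribonacciS m : turan tribonacci m.+3 =
  turan tribonacci m - turan tribonacci m.+1 - turan tribonacci m.+2.
Proof. rewrite /turan !tribonacciS !PoszD; ring. Qed.

(** The same reversal, for x^3 = x^2 + 1. *)
Lemma turan_narayanaS m : turan narayana m.+3 =
  turan narayana m - turan narayana m.+1.
Proof. rewrite /turan !narayanaS !PoszD; ring. Qed.

(** By the triangle inequality, the absolute values of the left-hand side grow no
    faster than the tribonacci recurrence allows. *)
Lemma turan_tribonacci_bound m : (3 <= m)%N ->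
  2 * `|turan tribonacci m| <= (tribonacci m.+1)%:Z.
Proof.
move: m; apply: three_step_induction => // n _; rewrite turan_tribonacciS.
rewrite (tribonacciS n.+1); lia.
Qed.

Lemma tribonacci_monotone n : (tribonacci n <= tribonacci n.+1)%N.
Proof. by case: n => [|[|n]] //; rewrite tribonacciS; lia. Qed.

Lemma narayana_monotone n : (narayana n <= narayana n.+1)%N.
Proof. by case: n => [|[|n]] //; rewrite narayanaS; lia. Qed.

(** The triangle inequality gives the bound a_{n+2} + a_{n+1}, which is at most
    a_{n+3} + a_{n+1} = a_{n+4} by monotonicity. *)
Lemma turan_narayana_bound m : (4 <= m)%N ->
  2 * `|turan narayana m| <= (narayana m.+1)%:Z.
Proof.
move: m; apply: three_step_induction => // n _; rewrite turan_narayanaS.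
have := narayana_monotone n.+2; rewrite (narayanaS n.+1); lia.
Qed.

Lemma tribonacci_gt0 m : (2 <= m)%N -> (0 < tribonacci m)%N.
Proof.
elim: m => // m IH; rewrite leq_eqVlt => /predU1P[<-//|/IH h].
exact: leq_trans h (tribonacci_monotone m).
Qed.

Lemma narayana_gt0 m : (2 <= m)%N -> (0 < narayana m)%N.
Proof.
elim: m => // m IH; rewrite leq_eqVlt => /predU1P[<-//|/IH h].
exact: leq_trans h (narayana_monotone m).
Qed.

Lemma tribonacci_le2 m : (2 <= m)%N -> (tribonacci m.+1 <= 2 * tribonacci m)%N.
Proof.
case: m => [|[|[|m]]] // _; rewrite (tribonacciS m.+1) tribonacciS; lia.
Qed.

Lemma narayana_le2 m : (2 <= m)%N -> (narayana m.+1 <= 2 * narayana m)%N.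
Proof.
case: m => [|[|m]] // _; rewrite narayanaS.
have := narayana_monotone m; have := narayana_monotone m.+1; lia.
Qed.

Lemma tribonacci_ge43 m : (3 <= m)%N -> (4 * tribonacci m <= 3 * tribonacci m.+1)%N.
Proof.
case: m => [|[|[|m]]] // _; rewrite (tribonacciS m.+1) tribonacciS.
have := tribonacci_monotone m; lia.
Qed.

Lemma narayana_ge43 m : (4 <= m)%N -> (4 * narayana m <= 3 * narayana m.+1)%N.
Proof.
case: m => [|[|[|[|m]]]] // _; rewrite (narayanaS m.+2).
have := @narayana_le2 m.+2 isT.
rewrite (narayanaS m.+1) (narayanaS m).
have := narayana_monotone m.+1; have := narayana_monotone m; lia.
Qed.

Theorem theorem3p1 (R : realType) :
  (forall n : nat, (4 <= n)%N ->
     nthroot n ((tribonacci n)%:R : R)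
       / nthroot (n - 1) ((tribonacci (n - 1))%:R : R)
     > nthroot (n + 1) ((tribonacci (n + 1))%:R : R)
         / nthroot n ((tribonacci n)%:R : R))
  /\
  (forall n : nat, (8 <= n)%N ->
     nthroot n ((narayana n)%:R : R)
       / nthroot (n - 1) ((narayana (n - 1))%:R : R)
     > nthroot (n + 1) ((narayana (n + 1))%:R : R)
         / nthroot n ((narayana n)%:R : R)).
Proof.
split.
(* N = 19 satisfies all conditions for both sequences. *)
- apply: (@nthroot_ratio_decr R _ 3 19) => [//|//|m h|m h|m h|m h|//||| ].
  + by apply: tribonacci_gt0; lia.
  + by apply: tribonacci_le2; lia.
  + by apply: tribonacci_ge43; lia.
  + by apply: turan_tribonacci_bound; lia.
  + by apply: leq_of_N; vm_compute.
  + by apply: leq_powers_of_N; vm_compute.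
  + by vm_compute.
- apply: (@nthroot_ratio_decr R _ 7 19) => [//|//|m h|m h|m h|m h|//||| ].
  + by apply: narayana_gt0; lia.
  + by apply: narayana_le2; lia.
  + by apply: narayana_ge43; lia.
  + by apply: turan_narayana_bound; lia.
  + by apply: leq_of_N; vm_compute.
  + by apply: leq_powers_of_N; vm_compute.
  + by vm_compute.
Qed.
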